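(* Let $p : X \to Y$ be a Weierstra{\ss} elliptic surface with section $\Theta$, and let $e = -\Theta^2$ be the negative of the self-intersection number of $\Theta$ on $X$. Let $m, \alpha \in \mathbb{R}_{>0}$ be constants, and assume that $m+\alpha-e$ and $m-\tfrac{e}{2}$ are both nonzero. Put $A = m+\alpha-e$ and $B = -(m-\tfrac{e}{2})$. Then the equation $$u = \left( (m+\alpha-e)-(m-\tfrac{e}{2})u^2\right)w$$ has a solution in $u$ as a convergent power series in $w$, namely $$u = \sum_{n=0}^\infty c_n A^{n+1}B^n w^{2n+1},$$ where $c_n$ is the $n$-th Catalan number, and the radius of convergence of this power series is $\frac{1}{2\sqrt{|AB|}}$.
   Context: The Catalan numbers $c_n$ ($n \geq 0$) are defined by $c_0 = 1$ and $c_n = \sum_{i+j=n-1} c_i c_j$ for $n \geq 1$ (sum over nonnegative integers $i,j$); equivalently $c_n = \frac{1}{n+1}\binom{2n}{n}$. A Weierstra{\ss} elliptic surface is a smooth projective surface $X$ with a flat morphism $p: X \to Y$ to a smooth projective curve, whose fibers are geometrically integral Gorenstein curves of arithmetic genus $1$, together with a section of $p$ whose image $\Theta$ does not meet any singular point of any fiber. The surface enters the statement only through the number $e = -\Theta^2$. *)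

(* Defs.v *)
From Stdlib Require Import Reals List Arith Lia.
From Coquelicot Require Import Coquelicot.
Import ListNotations.
Local Open Scope nat_scope.

(* [catalans n] is the list [c_n; ...; c_0]; pairing it with its reverse
   enumerates the pairs (c_i, c_j) with i + j = n. *)
Fixpoint catalans (n : nat) : list nat :=
  match n with
  | O => [1]
  | S n' =>
      let l := catalans n' in
      list_sum (map (fun p => fst p * snd p) (combine l (rev l))) :: l
  end.

Definition catalan (n : nat) : nat := hd 0 (catalans n).

Lemma catalans_eq (n : nat) : catalans n = map catalan (rev (seq 0 (S n))).
Proof.
induction n as [|n IH]; [reflexivity|].
rewrite seq_S, rev_app_distr.
change (catalans (S n) = catalan (S n) :: map catalan (rev (seq 0 (S n)))).
rewrite <- IH; reflexivity.
Qed.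

Lemma rev_seq_0 (n : nat) :
  rev (seq 0 (S n)) = map (fun i => n - i) (seq 0 (S n)).
Proof.
induction n as [|n IH]; [reflexivity|].
rewrite (seq_S (S n) 0), rev_app_distr, IH, <- (seq_S (S n) 0).
change (seq 0 (S (S n))) with (0 :: seq 1 (S n)).
rewrite <- (seq_shift (S n) 0), map_cons, map_map.
reflexivity.
Qed.

Lemma catalan_0 : catalan 0 = 1.
Proof. reflexivity. Qed.

Lemma catalan_S (n : nat) :
  catalan (S n) =
  list_sum (map (fun i => catalan i * catalan (n - i)) (seq 0 (S n))).
Proof.
change (catalan (S n)) with
  (list_sum (map (fun p => fst p * snd p)
     (combine (catalans n) (rev (catalans n))))).
rewrite catalans_eq, <- map_rev, rev_involutive, rev_seq_0, map_map.
f_equal; induction (seq 0 (S n)) as [|i l IH]; [reflexivity|].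
cbn [map combine fst snd]; rewrite IH; f_equal; apply Nat.mul_comm.
Qed.

(* Coefficient sequence of the power series sum_n b n * w ^ (2 n + 1). *)
Definition odd_coeffs (b : nat -> R) (k : nat) : R :=
  if Nat.odd k then b (Nat.div2 k) else 0%R.

(* Main.v *)
Require Import Defs.
From Stdlib Require Import Reals Arith List Lia Psatz.
From Coquelicot Require Import Coquelicot.
Open Scope R_scope.

(** The recursion says that the generating function [u] satisfies
    [u = (A + B u^2) w] formally.  Partial sums of [sum c_n 4^-n] satisfy
    [s' <= 1 + s^2 / 4], hence stay below 2, which gives the lower bound on the
    radius.  Conversely, wherever the series converges, its sum is a real root
    of [B w u^2 - u + A w], so [4 A B w^2 <= 1]; replacing [A] and [B] by their
    absolute values changes neither the radius nor the recursion, and yields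
    [4 |A B| w^2 <= 1]. *)

(** * Auxiliary facts on power series and finite sums *)

Lemma CV_radius_Rabs (a : nat -> R) :
  CV_radius (fun n => Rabs (a n)) = CV_radius a.
Proof.
apply Lub_Rbar_eqset; intros x.
split; apply ex_series_ext; intros n; now rewrite !Rabs_mult, Rabs_Rabsolu.
Qed.

Lemma is_pseries_const (c x : R) :
  is_pseries (fun n => if Nat.eqb n 0 then c else 0) x c.
Proof.
apply is_pseries_R.
apply (filterlim_ext (fun _ => c)); [|apply filterlim_const].
intros n; induction n as [|n IH].
- rewrite sum_O; simpl; ring.
- rewrite sum_Sn, <- IH; unfold plus; simpl; ring.
Qed.

(** Reindexes the Cauchy square of an odd series at an even index, where only pairs of odd indices
    contribute. *)
Lemma sum_f_R0_odd (f : nat -> R) (n : nat) :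
  (forall i, f (2 * i)%nat = 0) ->
  sum_f_R0 f (2 * S n) = sum_f_R0 (fun i => f (2 * i + 1)%nat) n.
Proof.
intros Hf; induction n as [|n IH].
- assert (H0 := Hf 0%nat); assert (H1 := Hf 1%nat); simpl in *.
  rewrite H0, H1; ring.
- replace (2 * S (S n))%nat with (S (S (2 * S n))) by lia.
  rewrite !tech5, IH.
  replace (S (S (2 * S n))) with (2 * S (S n))%nat by lia.
  rewrite Hf; replace (S (2 * S n)) with (2 * S n + 1)%nat by lia; ring.
Qed.

(** * The Catalan generating function on the closed disk of radius 1/4 *)

Lemma INR_list_sum_seq (f : nat -> nat) (n : nat) :
  INR (list_sum (map f (seq 0 (S n)))) = sum_f_R0 (fun i => INR (f i)) n.
Proof.
induction n as [|n IH].
- simpl; now rewrite Nat.add_0_r.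
- rewrite seq_S, map_app, list_sum_app, plus_INR, IH.
  simpl; now rewrite Nat.add_0_r.
Qed.

Lemma INR_catalan_S (n : nat) :
  INR (catalan (S n)) =
  PS_mult (fun i => INR (catalan i)) (fun i => INR (catalan i)) n.
Proof.
rewrite catalan_S, INR_list_sum_seq.
apply sum_eq; intros i _; apply mult_INR.
Qed.

(** The product on the right contains every term [f i * g j] with [i + j <= n]; its remaining terms
    are nonnegative. *)
Lemma sum_PS_mult_le (f g : nat -> R) (n : nat) :
  (forall i, 0 <= f i) -> (forall i, 0 <= g i) ->
  sum_f_R0 (PS_mult f g) n <= sum_f_R0 f n * sum_f_R0 g n.
Proof.
intros Hf Hg; destruct n as [|n]; [apply Rle_refl|].
rewrite cauchy_finite by lia.
rewrite <- (Rplus_0_r (sum_f_R0 (PS_mult f g) (S n))).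
apply Rplus_le_compat_l.
apply cond_pos_sum; intros k; apply cond_pos_sum; intros l.
now apply Rmult_le_pos.
Qed.

Lemma catalan_partial_sum_le (n : nat) :
  sum_f_R0 (fun k => INR (catalan k) * (1 / 4) ^ k) n <= 2.
Proof.
set (f := fun k => INR (catalan k) * (1 / 4) ^ k).
assert (Hf : forall k, 0 <= f k).
{ intros k; apply Rmult_le_pos; [apply pos_INR|apply pow_le; lra]. }
induction n as [|n IH]; [unfold f; simpl; lra|].
rewrite decomp_sum by lia.
(* The weight [(1/4)^(S k)] splits as [(1/4)^i * (1/4)^(k - i) * (1/4)], so the Catalan recursion
   becomes a convolution of [f] with itself. *)
rewrite (sum_eq _ (fun k => PS_mult f f k * (1 / 4))).
2:{ intros k _; unfold f at 1; rewrite INR_catalan_S; unfold PS_mult.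
    rewrite !(Rmult_comm (sum_f_R0 _ _)), !scal_sum.
    apply sum_eq; intros i Hi; unfold f.
    replace (S k) with (S (i + (k - i))) by lia.
    simpl; rewrite pow_add; ring. }
rewrite <- scal_sum; simpl Nat.pred.
assert (H := sum_PS_mult_le f f n Hf Hf).
assert (H0 := cond_pos_sum f n Hf).
replace (f 0%nat) with 1 by (unfold f; simpl; ring).
(* If [0 <= s <= 2], then [1 + s^2 / 4 <= 2]. *)
fold f in IH; nra.
Qed.

Lemma ex_pseries_catalan (x : R) :
  Rabs x <= 1 / 4 -> ex_pseries (fun n => INR (catalan n)) x.
Proof.
intros Hx; apply ex_pseries_R.
apply (ex_series_le (K := R_AbsRing) (V := R_CompleteNormedModule)
         _ (fun k => INR (catalan k) * (1 / 4) ^ k)).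
- intros n; change (norm ?y) with (Rabs y).
  rewrite Rabs_mult, <- RPow_abs, (Rabs_pos_eq (INR _)) by apply pos_INR.
  apply Rmult_le_compat_l; [apply pos_INR|].
  apply pow_incr; split; [apply Rabs_pos|exact Hx].
- assert (Hp : forall k, 0 <= INR (catalan k) * (1 / 4) ^ k).
  { intros k; apply Rmult_le_pos; [apply pos_INR|apply pow_le; lra]. }
  destruct (ex_finite_lim_seq_incr
    (sum_n (fun k => INR (catalan k) * (1 / 4) ^ k)) 2) as [l Hl].
  + intros n; rewrite sum_Sn; unfold plus; simpl.
    specialize (Hp (S n)); simpl in Hp; lra.
  + intros n; rewrite sum_n_Reals; apply catalan_partial_sum_le.
  + now exists l.
Qed.

(** * The series in [w]: quadratic equation, convergence and radius *)

Definition catalan_coeffs (A B : R) : nat -> R :=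
  odd_coeffs (fun n => INR (catalan n) * A ^ (n + 1) * B ^ n).

Lemma odd_coeffs_even (b : nat -> R) (n : nat) : odd_coeffs b (2 * n) = 0.
Proof. unfold odd_coeffs; now rewrite Nat.odd_even. Qed.

Lemma odd_coeffs_odd (b : nat -> R) (n : nat) : odd_coeffs b (2 * n + 1) = b n.
Proof.
unfold odd_coeffs; rewrite Nat.odd_odd.
now replace (2 * n + 1)%nat with (S (2 * n)) by lia; rewrite Nat.div2_succ_double.
Qed.

Lemma catalan_coeffs_rec (A B : R) (k : nat) :
  catalan_coeffs A B k =
  PS_incr_1 (fun j => (if Nat.eqb j 0 then A else 0)
    + B * PS_mult (catalan_coeffs A B) (catalan_coeffs A B) j) k.
Proof.
set (a := catalan_coeffs A B).
destruct (Nat.Even_or_Odd k) as [[n ->]|[n ->]].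
- unfold a at 1, catalan_coeffs; rewrite odd_coeffs_even.
  destruct n as [|n]; [reflexivity|].
  replace (2 * S n)%nat with (S (2 * n + 1)) by lia; unfold PS_incr_1.
  replace (2 * n + 1 =? 0)%nat with false by (symmetry; apply Nat.eqb_neq; lia).
  (* Two indices with odd sum include an even one, so each product vanishes. *)
  unfold PS_mult; rewrite (sum_eq _ (fun _ => 0)).
  + rewrite sum_cte; ring.
  + intros i Hi; destruct (Nat.Even_or_Odd i) as [[j ->]|[j ->]].
    * unfold a at 1, catalan_coeffs; rewrite odd_coeffs_even; ring.
    * replace (2 * n + 1 - (2 * j + 1))%nat with (2 * (n - j))%nat by lia.
      unfold a at 2, catalan_coeffs; rewrite odd_coeffs_even; ring.
- unfold a at 1, catalan_coeffs; rewrite odd_coeffs_odd.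
  replace (2 * n + 1)%nat with (S (2 * n)) by lia; unfold PS_incr_1.
  destruct n as [|n].
  (* The coefficient of [w] is [A] alone, because [a 0 = 0] kills the quadratic term. *)
  + unfold PS_mult, a, catalan_coeffs, odd_coeffs; simpl; ring.
  + replace (2 * S n =? 0)%nat with false
      by (symmetry; apply Nat.eqb_neq; lia).
    unfold PS_mult; rewrite sum_f_R0_odd.
    2:{ intros i; unfold a at 1, catalan_coeffs; rewrite odd_coeffs_even; ring. }
    rewrite INR_catalan_S; unfold PS_mult.
    rewrite Rplus_0_l, scal_sum, Rmult_assoc, Rmult_comm, scal_sum.
    apply sum_eq; intros i Hi.
    replace (2 * S n - (2 * i + 1))%nat with (2 * (n - i) + 1)%nat by lia.
    unfold a, catalan_coeffs; rewrite !odd_coeffs_odd.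
    replace (S n + 1)%nat with ((i + 1) + ((n - i) + 1))%nat by lia.
    replace (S n) with (S (i + (n - i))) by lia.
    simpl; rewrite !pow_add; ring.
Qed.

Lemma PSeries_catalan_coeffs (A B w : R) :
  Rbar_lt (Rabs w) (CV_radius (catalan_coeffs A B)) ->
  PSeries (catalan_coeffs A B) w =
  (A + B * PSeries (catalan_coeffs A B) w ^ 2) * w.
Proof.
intros Hw; set (a := catalan_coeffs A B) in *.
rewrite (PSeries_ext a _ w (catalan_coeffs_rec A B)) at 1.
rewrite PSeries_incr_1, Rmult_comm; f_equal.
(* The recursion is, up to conversion, a combination of power series operations, so it can be summed
   termwise. *)
change (PSeries (PS_plus (fun j => if Nat.eqb j 0 then A else 0)
  (PS_scal B (PS_mult a a))) w = A + B * PSeries a w ^ 2).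
rewrite PSeries_plus.
- rewrite (is_pseries_unique _ _ _ (is_pseries_const A w)).
  rewrite PSeries_scal, PSeries_mult by assumption; ring.
- eexists; apply is_pseries_const.
- apply ex_pseries_scal; [apply Rmult_comm|now apply ex_pseries_mult].
Qed.

Lemma catalan_coeffs_radius_le (A B w : R) :
  Rbar_lt (Rabs w) (CV_radius (catalan_coeffs A B)) ->
  4 * Rabs (A * B) * w ^ 2 <= 1.
Proof.
intros Hw.
assert (Ha : CV_radius (catalan_coeffs (Rabs A) (Rabs B)) =
             CV_radius (catalan_coeffs A B)).
{ rewrite <- (CV_radius_Rabs (catalan_coeffs A B)).
  apply CV_radius_ext; intros k; unfold catalan_coeffs, odd_coeffs.
  destruct (Nat.odd k); [|now rewrite Rabs_R0].
  now rewrite !Rabs_mult, <- !RPow_abs, (Rabs_pos_eq (INR _)) by apply pos_INR. }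
rewrite <- Ha in Hw.
assert (H := PSeries_catalan_coeffs _ _ _ Hw).
set (u := PSeries _ w) in H.
rewrite Rabs_mult.
(* The discriminant is a square: [(2 B w u - 1)^2 = 1 - 4 A B w^2]. *)
assert (H2 := pow2_ge_0 (2 * Rabs B * w * u - 1)).
(* The equation multiplied by [Rabs B * w] eliminates [u] from the expanded square. *)
assert (H3 : Rabs B * w * u = Rabs B * w * ((Rabs A + Rabs B * u ^ 2) * w))
  by now rewrite <- H.
nra.
Qed.

(** The substitution [x = A * B * w^2] reduces both convergence claims to the Catalan series at
    [Rabs x <= 1/4]. The non-strict bound also covers the circle of convergence. *)
Lemma is_pseries_catalan_coeffs (A B w : R) :
  4 * Rabs (A * B) * w ^ 2 <= 1 ->
  exists u : R,
    is_series (fun n => INR (catalan n) * A ^ (n + 1) * B ^ n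
                        * w ^ (2 * n + 1)) u /\
    is_pseries (catalan_coeffs A B) w u.
Proof.
intros Hw.
destruct (ex_pseries_catalan (A * B * w ^ 2)) as [s Hs].
{ rewrite Rabs_mult, (Rabs_pos_eq (w ^ 2)) by apply pow2_ge_0; lra. }
apply is_pseries_R in Hs.
exists (w * (A * s)); split.
- rewrite <- Rmult_assoc.
  apply (is_series_ext (fun n => (w * A) *
    (INR (catalan n) * (A * B * w ^ 2) ^ n))).
  + intros n; change (w * A * (INR (catalan n) * (A * B * w ^ 2) ^ n) =
      INR (catalan n) * A ^ (n + 1) * B ^ n * w ^ (2 * n + 1)).
    rewrite !pow_add, !Rpow_mult_distr, pow_mult; simpl; ring.
  + apply (is_series_scal (K := R_AbsRing) (V := R_NormedModule) (w * A)), Hs.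
(* The even part sums to 0, and the odd part is [w] times a series in [w^2] with sum [A * s]. *)
- rewrite <- (Rplus_0_l (w * (A * s))); apply is_pseries_odd_even;
    apply is_pseries_R.
  + apply (is_series_ext (fun _ => 0)).
    * intros n; unfold catalan_coeffs; now rewrite odd_coeffs_even, Rmult_0_l.
    * apply (filterlim_ext (fun _ => 0)); [|apply filterlim_const].
      intros n; rewrite sum_n_Reals, sum_cte; ring.
  + apply (is_series_ext (fun n => A *
      (INR (catalan n) * (A * B * w ^ 2) ^ n))).
    * intros n; unfold catalan_coeffs; rewrite odd_coeffs_odd.
      change (A * (INR (catalan n) * (A * B * w ^ 2) ^ n) =
        INR (catalan n) * A ^ (n + 1) * B ^ n * (w ^ 2) ^ n).
      rewrite !pow_add, !Rpow_mult_distr; simpl; ring.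
    * apply (is_series_scal (K := R_AbsRing) (V := R_NormedModule) A), Hs.
Qed.

Lemma CV_radius_catalan_coeffs (A B : R) :
  A * B <> 0 ->
  CV_radius (catalan_coeffs A B) = Finite (1 / (2 * sqrt (Rabs (A * B)))).
Proof.
intros HAB; set (a := catalan_coeffs A B).
assert (HP : 0 < Rabs (A * B)) by now apply Rabs_pos_lt.
assert (Hq := sqrt_lt_R0 _ HP).
set (rho := 1 / (2 * sqrt (Rabs (A * B)))).
assert (Hrho : 0 < rho) by (apply Rdiv_lt_0_compat; lra).
assert (Hr : 4 * Rabs (A * B) * rho ^ 2 = 1).
{ unfold rho; rewrite <- (pow2_sqrt (Rabs (A * B))) at 1 by lra; field; lra. }
apply Rbar_le_antisym; apply Rbar_not_lt_le; intros H.
(* A point strictly between [rho] and a larger radius would have [4 * Rabs (A * B) * w^2 > 1]. *)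
- assert (Hw : exists w, rho < w /\ Rbar_lt w (CV_radius a)).
  { destruct (CV_radius a) as [r| |]; simpl in H.
    - exists ((rho + r) / 2); simpl; lra.
    - exists (rho + 1); simpl; lra.
    - contradiction. }
  destruct Hw as [w [Hw1 Hw2]].
  rewrite <- (Rabs_pos_eq w) in Hw2 by lra.
  assert (H1 := catalan_coeffs_radius_le A B w Hw2).
  nra.
(* The series converges at [rho] itself, so its terms tend to 0 there; this cannot happen outside
   the closed disk of convergence. *)
- destruct (is_pseries_catalan_coeffs A B rho) as [u [_ Hu]]; [lra|].
  rewrite <- (Rabs_pos_eq rho) in H by lra.
  apply (CV_disk_outside a rho H), ex_series_lim_0.
  exists u; now apply is_pseries_R.
Qed.

Theorem proposition3p7 (e : Z) (m alpha : R)
  (hm : 0 < m) (halpha : 0 < alpha)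
  (hA : m + alpha - IZR e <> 0) (hB : m - IZR e / 2 <> 0) :
  let A := m + alpha - IZR e in
  let B := - (m - IZR e / 2) in
  let a := odd_coeffs (fun n => INR (catalan n) * A ^ (n + 1) * B ^ n) in
  let rho := 1 / (2 * sqrt (Rabs (A * B))) in
  (* the equation, as an identity of formal power series in w *)
  (forall k : nat,
     a k = PS_incr_1 (fun j =>
             (if Nat.eqb j 0 then m + alpha - IZR e else 0)
             - (m - IZR e / 2) * PS_mult a a j) k) /\
  (* the equation, as an identity of convergent sums *)
  (forall w : R, Rabs w < rho ->
     exists u : R,
       is_series (fun n => INR (catalan n) * A ^ (n + 1) * B ^ n
                           * w ^ (2 * n + 1)) u /\
       is_pseries a w u /\
       u = ((m + alpha - IZR e) - (m - IZR e / 2) * u ^ 2) * w) /\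
  CV_radius a = Finite rho.
Proof.
intros A B a rho.
assert (Hrad : CV_radius a = Finite rho).
{ apply CV_radius_catalan_coeffs; unfold A, B; nra. }
split; [|split; [|exact Hrad]].
- intros k; unfold a; fold (catalan_coeffs A B); rewrite catalan_coeffs_rec.
  destruct k as [|k]; [reflexivity|]; simpl PS_incr_1; unfold A, B; ring.
- intros w Hw.
  assert (Hw' : Rbar_lt (Rabs w) (CV_radius (catalan_coeffs A B))).
  { now change (Rbar_lt (Rabs w) (CV_radius a)); rewrite Hrad. }
  destruct (is_pseries_catalan_coeffs A B w) as [u [Hu1 Hu2]].
  (* The necessary condition for lying inside the disk is exactly the sufficient condition for
     convergence. *)
  { now apply catalan_coeffs_radius_le. }
  exists u; split; [exact Hu1|split; [exact Hu2|]].
  assert (H := PSeries_catalan_coeffs A B w Hw').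
  rewrite (is_pseries_unique _ _ _ Hu2) in H.
  rewrite H at 1; unfold A, B; ring.
Qed.
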